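(* For every $\mathsf{Frege}$ derivation $\Upsilon$ with premisses $\alpha_1,\dots,\alpha_h$, where $h\ge0$, and conclusion $\beta$, there is a derivation $\Phi$ in the CoS system $\mathsf{SKSg}$ with premiss $(\alpha_1\wedge\dots\wedge\alpha_h)$ and conclusion $\beta$; if $l$ and $n$ are respectively the length and size of $\Upsilon$, then the length and size of $\Phi$ are respectively $O(l)$ and $O(n^2)$.
   Context: CoS: formulae are built from units $\mathsf f,\mathsf t$, atoms $a,\bar a,\dots$, formula variables $A,\bar A,\dots$ by $[\alpha\vee\beta]$ and $(\alpha\wedge\beta)$; $\bar\cdot$ is an involution on atoms and on variables ($\bar a\ne a$); the De Morgan dual $\bar\alpha$ exchanges $\vee/\wedge$, $\mathsf t/\mathsf f$ and negates atoms and variables. Equality $=$ is the smallest context-closed equivalence containing commutativity and associativity of $\vee,\wedge$, $[\alpha\vee\mathsf f]=\alpha$, $(\alpha\wedge\mathsf t)=\alpha$, $[\mathsf t\vee\mathsf t]=\mathsf t$, $(\mathsf f\wedge\mathsf f)=\mathsf f$. A rule $\alpha/\beta$ has instances $\alpha\rho\sigma/\beta\rho\sigma$ for a renaming $\rho$ and substitution $\sigma$ (variables to formulae, $\bar A\mapsto$ dual); it generates steps $\xi\{\gamma\}/\xi\{\delta\}$ for any context (formula with one hole) $\xi$. A derivation in $\mathcal S$ with premiss $\alpha_0$ and conclusion $\alpha_k$ is a chain $\alpha_0,\dots,\alpha_k$ alternating $=$-steps and steps generated by rules of $\mathcal S$; its length is $k$; its size is the number of occurrences of units, atoms and variables in it.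 $\mathsf{SKSg}$ has rules $\mathsf t/[A\vee\bar A]$, $(A\wedge\bar A)/\mathsf f$, $\mathsf f/A$, $A/\mathsf t$, $[A\vee A]/A$, $A/(A\wedge A)$, $(A\wedge[B\vee C])/[(A\wedge B)\vee C]$. An empty conjunction (case $h=0$) is represented by $\mathsf t$. $\mathsf{Frege}$: formulae over $\mathsf t,\mathsf f$, non-negated variables, $\vee,\wedge,\to,\neg$; axiom schemes $F_1: A\to(B\to(A\wedge B))$; $F_2:(A\wedge B)\to A$; $F_3:(A\wedge B)\to B$; $F_4:A\to(A\vee B)$; $F_5:B\to(A\vee B)$; $F_6:\neg\neg A\to A$; $F_7:A\to\neg\neg A$; $F_8:A\to(B\to A)$; $F_9:\neg A\to(A\to B)$; $F_{10}:(A\to(B\to C))\to((A\to B)\to(A\to C))$; $F_{11}:(A\to C)\to((B\to C)\to((A\vee B)\to C))$; $F_{12}:(A\to(B\to C))\to(B\to(A\to C))$; $F_{13}:(A\to B)\to(\neg B\to\neg A)$; $F_{14}:\mathsf f\to(A\wedge\neg A)$; $F_{15}:(A\wedge\neg A)\to\mathsf f$; $F_{16}:\mathsf t\to(A\vee\neg A)$; $F_{17}:(A\vee\neg A)\to\mathsf t$ (instances by substituting formulae), and modus ponens (from $A$ and $A\to B$ infer $B$). A Frege derivation with premisses $\alpha_1,\dots,\alpha_h$ and conclusion $\beta_l$ is a sequence $\beta_1,\dots,\beta_l$ each being a premiss, an axiom instance, or the conclusion of modus ponens from earlier members; its length is $l$ and its size the number of occurrences of units and variables. Translation: Frege variables correspond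 to CoS atoms or variables, $\neg$ of a variable to the negated atom/variable, $\neg\alpha$ to the dual, $\alpha\to\beta$ to $[\bar\alpha\vee\beta]$, and $\vee,\wedge$ to themselves.
   Formalization: The size bound O(n^2) is stated when every listed premiss occurs in the Frege derivation (with multiplicity); in general it is O(n^2 + size of the premiss conjunction), since an idle premiss of arbitrary size makes the literal bound false. *)

(* Defs.v *)
From HB Require Import structures.
From mathcomp Require Import all_boot.

Set Implicit Arguments.
Unset Strict Implicit.
Unset Printing Implicit Defensive.

(* An atom or formula variable is a name with a polarity; the involution flips
   the polarity. *)
Definition name : Type := (nat * bool)%type.
Definition bar (x : name) : name := (x.1, ~~ x.2).

Inductive formula : Type :=
  | CoF
  | CoT
  | CoAtom of name
  | CoVar of name
  | CoOr of formula & formula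
  | CoAnd of formula & formula.

Lemma formula_eq_dec : comparable formula.
Proof. by rewrite /comparable /decidable; do 3 decide equality. Qed.

HB.instance Definition _ := hasDecEq.Build formula (compareP formula_eq_dec).

Declare Scope cos_scope.
Delimit Scope cos_scope with cos.
Bind Scope cos_scope with formula.
Notation "A || B" := (CoOr A B) : cos_scope.
Notation "A && B" := (CoAnd A B) : cos_scope.

Fixpoint dual (a : formula) : formula :=
  match a with
  | CoF => CoT
  | CoT => CoF
  | CoAtom x => CoAtom (bar x)
  | CoVar x => CoVar (bar x)
  | CoOr b c => CoAnd (dual b) (dual c)
  | CoAnd b c => CoOr (dual b) (dual c)
  end.

Fixpoint csize (a : formula) : nat :=
  match a with
  | CoOr b c | CoAnd b c => csize b + csize c
  | _ => 1
  end.

Inductive context : Type :=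
  | Hole
  | OrL of context & formula
  | OrR of formula & context
  | AndL of context & formula
  | AndR of formula & context.

Fixpoint fill (xi : context) (a : formula) : formula :=
  match xi with
  | Hole => a
  | OrL xi' b => CoOr (fill xi' a) b
  | OrR b xi' => CoOr b (fill xi' a)
  | AndL xi' b => CoAnd (fill xi' a) b
  | AndR b xi' => CoAnd b (fill xi' a)
  end.

Inductive cos_eq : formula -> formula -> Prop :=
  | coseq_refl a : cos_eq a a
  | coseq_sym a b : cos_eq a b -> cos_eq b a
  | coseq_trans a b c : cos_eq a b -> cos_eq b c -> cos_eq a c
  | coseq_fill xi a b : cos_eq a b -> cos_eq (fill xi a) (fill xi b)
  | coseq_orC a b : cos_eq (a || b) (b || a)
  | coseq_andC a b : cos_eq (a && b) (b && a)
  | coseq_orA a b c : cos_eq ((a || b) || c) (a || (b || c))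
  | coseq_andA a b c : cos_eq ((a && b) && c) (a && (b && c))
  | coseq_orF a : cos_eq (a || CoF) a
  | coseq_andT a : cos_eq (a && CoT) a
  | coseq_orTT : cos_eq (CoT || CoT) CoT
  | coseq_andFF : cos_eq (CoF && CoF) CoF.

Definition renaming (rho : name -> name) : Prop :=
  forall x, rho (bar x) = bar (rho x).

Definition substitution (sigma : name -> formula) : Prop :=
  forall x, sigma (bar x) = dual (sigma x).

Fixpoint rename (rho : name -> name) (a : formula) : formula :=
  match a with
  | CoAtom x => CoAtom (rho x)
  | CoOr b c => CoOr (rename rho b) (rename rho c)
  | CoAnd b c => CoAnd (rename rho b) (rename rho c)
  | _ => a
  end.

Fixpoint subst (sigma : name -> formula) (a : formula) : formula :=
  match a with
  | CoVar x => sigma x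
  | CoOr b c => CoOr (subst sigma b) (subst sigma c)
  | CoAnd b c => CoAnd (subst sigma b) (subst sigma c)
  | _ => a
  end.

(* A rule is the pair of its premiss and its conclusion. *)
Definition rule : Type := (formula * formula)%type.
Definition system : Type := seq rule.

Definition rule_instance (r : rule) (c d : formula) : Prop :=
  exists rho sigma, [/\ renaming rho, substitution sigma,
    c = subst sigma (rename rho r.1) & d = subst sigma (rename rho r.2)].

Definition rule_step (S : system) (a b : formula) : Prop :=
  exists r xi c d, [/\ r \in S, rule_instance r c d,
    a = fill xi c & b = fill xi d].

(* [chain S e a s]: the formulae of [s], starting from [a], are reached by
   steps that alternate strictly, the first one being an =-step iff [e]. *)
Fixpoint chain (S : system) (e : bool) (a : formula) (s : seq formula) : Prop :=
  if s is b :: s' then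
    (if e then cos_eq a b else rule_step S a b) /\ chain S (~~ e) b s'
  else True.

Definition derivation (S : system) (a b : formula) (Phi : seq formula) : Prop :=
  exists e s, [/\ Phi = a :: s, last a s = b & chain S e a s].

(* The length counts steps, not formulae. *)
Definition dlength (Phi : seq formula) : nat := (size Phi).-1.
Definition dsize (Phi : seq formula) : nat := sumn (map csize Phi).

Section SKSg.
Let A := CoVar (0, true).
Let B := CoVar (1, true).
Let C := CoVar (2, true).

Definition SKSg : system := [::
  (CoT, A || dual A);
  (A && dual A, CoF);
  (CoF, A);
  (A, CoT);
  (A || A, A);
  (A, A && A);
  (A && (B || C), (A && B) || C)]%cos.
End SKSg.

Definition bigconj (s : seq formula) : formula :=
  if s is a :: s' then foldl CoAnd a s' else CoT.

Inductive fformula : Type :=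
  | FrF
  | FrT
  | FrVar of nat
  | FrOr of fformula & fformula
  | FrAnd of fformula & fformula
  | FrImp of fformula & fformula
  | FrNot of fformula.

Lemma fformula_eq_dec : comparable fformula.
Proof. by rewrite /comparable /decidable; do 2 decide equality. Qed.

HB.instance Definition _ := hasDecEq.Build fformula (compareP fformula_eq_dec).

Declare Scope frege_scope.
Delimit Scope frege_scope with frege.
Bind Scope frege_scope with fformula.
Notation "A || B" := (FrOr A B) : frege_scope.
Notation "A && B" := (FrAnd A B) : frege_scope.
Notation "A ==> B" := (FrImp A B) : frege_scope.
Notation "~~ A" := (FrNot A) : frege_scope.

Fixpoint frsize (a : fformula) : nat :=
  match a with
  | FrOr b c | FrAnd b c | FrImp b c => frsize b + frsize c
  | FrNot b => frsize b
  | _ => 1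
  end.

Fixpoint frsubst (sigma : nat -> fformula) (a : fformula) : fformula :=
  match a with
  | FrVar x => sigma x
  | FrOr b c => FrOr (frsubst sigma b) (frsubst sigma c)
  | FrAnd b c => FrAnd (frsubst sigma b) (frsubst sigma c)
  | FrImp b c => FrImp (frsubst sigma b) (frsubst sigma c)
  | FrNot b => FrNot (frsubst sigma b)
  | _ => a
  end.

Section FregeAxioms.
Let A := FrVar 0.
Let B := FrVar 1.
Let C := FrVar 2.

Definition frege_schemes : seq fformula := [::
  A ==> (B ==> (A && B));
  (A && B) ==> A;
  (A && B) ==> B;
  A ==> (A || B);
  B ==> (A || B);
  (~~ ~~ A) ==> A;
  A ==> (~~ ~~ A);
  A ==> (B ==> A);
  (~~ A) ==> (A ==> B);
  (A ==> (B ==> C)) ==> ((A ==> B) ==> (A ==> C));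
  (A ==> C) ==> ((B ==> C) ==> ((A || B) ==> C));
  (A ==> (B ==> C)) ==> (B ==> (A ==> C));
  (A ==> B) ==> ((~~ B) ==> (~~ A));
  FrF ==> (A && (~~ A));
  (A && (~~ A)) ==> FrF;
  FrT ==> (A || (~~ A));
  (A || (~~ A)) ==> FrT]%frege.
End FregeAxioms.

Definition frege_axiom (c : fformula) : Prop :=
  exists F sigma, F \in frege_schemes /\ c = frsubst sigma F.

Definition frege_derivation
    (alphas : seq fformula) (beta : fformula) (Ups : seq fformula) : Prop :=
  (exists s, Ups = rcons s beta) /\
  forall s c s', Ups = s ++ c :: s' ->
    [\/ c \in alphas, frege_axiom c
      | exists2 a, a \in s & FrImp a c \in s].

Definition frlength (Ups : seq fformula) : nat := size Ups.
Definition frdsize (Ups : seq fformula) : nat := sumn (map frsize Ups).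

(* [tau] sends a Frege variable to an atom ([inl]) or a variable ([inr]). *)
Fixpoint translate (tau : nat -> name + name) (a : fformula) : formula :=
  match a with
  | FrF => CoF
  | FrT => CoT
  | FrVar x => match tau x with inl y => CoAtom y | inr y => CoVar y end
  | FrOr b c => CoOr (translate tau b) (translate tau c)
  | FrAnd b c => CoAnd (translate tau b) (translate tau c)
  | FrImp b c => CoOr (dual (translate tau b)) (translate tau c)
  | FrNot b => dual (translate tau b)
  end.

(* The definition of a Frege derivation lets premisses be idle or be listed
   more often than they are used.  Such premisses count in every CoS derivation
   from their conjunction, but not in the size of the Frege derivation, and no
   function of the latter can then bound the size of the former.  This says
   that every listed premiss has its own occurrence in the derivation. *)
Definition premisses_occur (alphas Ups : seq fformula) : Prop :=
  forall a, count_mem a alphas <= count_mem a Ups.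

(* Main.v *)
(* Each line of the Frege derivation is simulated in a conjunction of all the
   formulae derived so far: an axiom is introduced in place of a unit t, and modus
   ponens copies its two premisses and applies switch and the contradiction rule
   to the copies.  As there are finitely many schemes and rules, one CoS
   derivation is fixed for each and then instantiated; every line hence costs O(1)
   steps through formulae of size O(n), and l <= n gives O(n^2).  The premisses are
   first weakened to one copy of each that occurs in the Frege derivation, so that
   the conjunction carried along has size O(n). *)
Require Import Defs.
From mathcomp Require Import all_boot.
From mathcomp Require Import zify.

Set Implicit Arguments.
Unset Strict Implicit.
Unset Printing Implicit Defensive.

(** * Duality, formula size and substitution *)

Lemma barK : involutive bar.
Proof. by case=> x p; rewrite /bar /= negbK. Qed.

Lemma dualK : involutive dual.
Proof. by elim=> //= [x|x|a -> b ->|a -> b ->]; rewrite ?barK. Qed.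

Lemma csize_dual a : csize (dual a) = csize a.
Proof. by elim: a => //= a -> b ->. Qed.

Lemma csize_gt0 a : 0 < csize a.
Proof. by elim: a => //= *; rewrite addn_gt0; apply/orP; left. Qed.

Lemma csize_translate tau a : csize (translate tau a) = frsize a.
Proof.
elim: a => //= [x|a -> b ->|a -> b ->|a IHa b IHb|a IHa] //.
- by case: (tau x).
- by rewrite csize_dual IHa IHb.
- by rewrite csize_dual.
Qed.

Lemma subst_dual sigma a :
  substitution sigma -> subst sigma (dual a) = dual (subst sigma a).
Proof. by move=> sg; elim: a => //= a -> b ->. Qed.

Lemma subst_subst sigma sigma' a :
  subst sigma (subst sigma' a) = subst (subst sigma \o sigma') a.
Proof. by elim: a => //= a -> b ->. Qed.

Lemma csize_subst K sigma a : (forall x, csize (sigma x) <= K) -> 0 < K ->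
  csize (subst sigma a) <= csize a * K.
Proof.
by move=> sgK K0; elim: a => //= *; rewrite ?mul1n ?mulnDl ?leq_add.
Qed.

Lemma rename_id a : rename id a = a.
Proof. by elim: a => //= a -> b ->. Qed.

(** Makes an arbitrary assignment of formulae to indices respect the polarity, so that it may
    instantiate a rule or a fixed derivation. *)
Definition literal_subst (f : nat -> formula) (x : name) : formula :=
  if x.2 then f x.1 else dual (f x.1).

Lemma literal_substP f : substitution (literal_subst f).
Proof. by case=> x [] //=; rewrite /literal_subst /= dualK. Qed.

(** * Stability of =-steps and rule steps under substitution and contexts *)

Fixpoint context_subst (sigma : name -> formula) (xi : context) : context :=
  match xi with
  | Hole => Hole
  | OrL xi' b => OrL (context_subst sigma xi') (subst sigma b)
  | OrR b xi' => OrR (subst sigma b) (context_subst sigma xi')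
  | AndL xi' b => AndL (context_subst sigma xi') (subst sigma b)
  | AndR b xi' => AndR (subst sigma b) (context_subst sigma xi')
  end.

Lemma subst_fill sigma xi a :
  subst sigma (fill xi a) = fill (context_subst sigma xi) (subst sigma a).
Proof. by elim: xi => //= [xi ->|b xi ->|xi ->|b xi ->]. Qed.

Fixpoint context_comp (xi xi' : context) : context :=
  match xi with
  | Hole => xi'
  | OrL xi0 b => OrL (context_comp xi0 xi') b
  | OrR b xi0 => OrR b (context_comp xi0 xi')
  | AndL xi0 b => AndL (context_comp xi0 xi') b
  | AndR b xi0 => AndR b (context_comp xi0 xi')
  end.

Lemma fill_comp xi xi' a : fill (context_comp xi xi') a = fill xi (fill xi' a).
Proof. by elim: xi => //= [xi ->|b xi ->|xi ->|b xi ->]. Qed.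

(** The unit [CoF] marks the place of the hole, so the right-hand side exceeds the exact size by
    one. *)
Lemma csize_fill xi a : csize (fill xi a) <= csize a + csize (fill xi CoF).
Proof. by elim: xi => //= [|xi|b xi|xi|b xi]; lia. Qed.

Lemma cos_eq_and a a' b b' :
  cos_eq a a' -> cos_eq b b' -> cos_eq (a && b) (a' && b').
Proof.
move=> aa' bb'; apply: (@coseq_trans _ (a' && b)).
  exact: (@coseq_fill (AndL Hole b)).
exact: (@coseq_fill (AndR a' Hole)).
Qed.

Lemma cos_eq_subst sigma a b :
  cos_eq a b -> cos_eq (subst sigma a) (subst sigma b).
Proof.
elim=> {a b} //=; try by constructor.
- by move=> a b c _ ab _ bc; apply: coseq_trans bc.
- by move=> xi a b _ IH; rewrite !subst_fill; apply: coseq_fill.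
Qed.

(** Substitutions compose: since [subst sigma] commutes with [dual], the composite again respects
    [bar], and an instance of a rule instance is a rule instance. *)
Lemma rule_step_subst S sigma a b : substitution sigma ->
  rule_step S a b -> rule_step S (subst sigma a) (subst sigma b).
Proof.
move=> sg [r [xi [c [d [rS [rho [sg' [rhoP sg'P -> ->]]] -> ->]]]]].
rewrite !subst_fill !subst_subst; exists r, (context_subst sigma xi).
do 2 eexists; split; [by []| |by []|by []].
exists rho, (subst sigma \o sg'); split=> // x /=.
by rewrite sg'P subst_dual.
Qed.

Lemma rule_step_fill S xi a b :
  rule_step S a b -> rule_step S (fill xi a) (fill xi b).
Proof.
move=> [r [xi' [c [d [rS rcd -> ->]]]]].
by exists r, (context_comp xi xi'), c, d; rewrite !fill_comp.
Qed.

(** * Bounded reachability *)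

(* At most [r] rule steps, separated by =-steps, through formulae of size at
   most [m]. *)
Inductive reach (m : nat) : nat -> formula -> formula -> Prop :=
  | reach_eq r a b : cos_eq a b -> csize b <= m -> reach m r a b
  | reach_step r a a' b' b : cos_eq a a' -> rule_step SKSg a' b' ->
      csize a' <= m -> csize b' <= m -> reach m r b' b -> reach m r.+1 a b.

(** The size bound in [reach] does not cover the starting formula, so a leading =-step is absorbed
    at no cost. *)
Lemma reach_eql m r a b c : cos_eq a b -> reach m r b c -> reach m r a c.
Proof.
move=> ab bc; case: bc ab => {r b c} [r b c bc cm|r b a' b' c ba' st a'm b'm b'c] ab.
  by apply: reach_eq cm; apply: coseq_trans bc.
by apply: reach_step st a'm b'm b'c; apply: coseq_trans ba'.
Qed.

Lemma reach_leq m m' r r' a b :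
  m <= m' -> r <= r' -> reach m r a b -> reach m' r' a b.
Proof.
move=> mm' + ab; elim: ab r' => {r a b} [r a b ab bm|r a a' b' b ab st am bm _ IH] r' rr'.
  by apply: reach_eq => //; lia.
case: r' rr' => // r' rr'; apply: reach_step st _ _ (IH _ _) => //; lia.
Qed.

(** The =-step closing the first part merges with the one opening the second, which keeps the
    alternation strict. *)
Lemma reach_trans m r r' a b c :
  reach m r a b -> reach m r' b c -> reach m (r + r') a c.
Proof.
move=> ab bc; elim: ab bc => {r a b} [r a b ab _|r a a' b' b ab st am bm _ IH] bc.
  by apply: reach_eql ab _; apply: reach_leq bc; lia.
by rewrite addSn; apply: reach_step st am bm (IH bc).
Qed.

Lemma reach_fill xi m r a b : reach m r a b ->
  reach (m + csize (fill xi CoF)) r (fill xi a) (fill xi b).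
Proof.
have le c : csize c <= m -> csize (fill xi c) <= m + csize (fill xi CoF).
  by have := csize_fill xi c; lia.
elim=> {r a b} [r a b ab bm|r a a' b' b ab st am bm _ IH].
  by apply: reach_eq; [apply: coseq_fill|apply: le].
apply: reach_step (rule_step_fill xi st) (le _ am) (le _ bm) IH.
exact: coseq_fill.
Qed.

Lemma reach_subst K sigma m r a b :
  substitution sigma -> (forall x, csize (sigma x) <= K) -> 0 < K ->
  reach m r a b -> reach (m * K) r (subst sigma a) (subst sigma b).
Proof.
move=> sg sgK K0.
have le c : csize c <= m -> csize (subst sigma c) <= m * K.
  by move=> cm; apply: leq_trans (csize_subst c sgK K0) _; rewrite leq_mul2r cm orbT.
elim=> {r a b} [r a b ab bm|r a a' b' b ab st am bm _ IH].
  by apply: reach_eq; [apply: cos_eq_subst|apply: le].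
apply: reach_step (rule_step_subst sg st) (le _ am) (le _ bm) IH.
exact: cos_eq_subst.
Qed.

(** Each rule step contributes the two formulae around it, and the closing =-step one more. *)
Lemma reach_chain m r a b : reach m r a b ->
  exists s, [/\ last a s = b, chain SKSg true a s, size s <= (2 * r).+1
    & sumn (map csize s) <= (2 * r).+1 * m].
Proof.
elim=> {r a b} [r a b ab bm|r a a' b' b ab st am bm _ [s [lasts chs szs sums]]].
  by exists [:: b]; split=> //=; lia.
by exists [:: a', b' & s]; split=> //=; lia.
Qed.

(** * Derivability without bounds *)

(* Bounds are dropped here and recovered by [proves_subst]: all instances of one
   derivation share its number of steps, and their size is linear in that of
   the substituted formulae. *)
Definition proves (a b : formula) : Prop := exists k, reach k k a b.

Lemma proves_eq a b : cos_eq a b -> proves a b.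
Proof. by move=> ab; exists (csize b); apply: reach_eq. Qed.

Lemma proves_refl a : proves a a.
Proof. exact/proves_eq/coseq_refl. Qed.

Lemma proves_trans b a c : proves a b -> proves b c -> proves a c.
Proof.
move=> [k ab] [k' bc]; exists (k + k').
by apply: reach_trans; [apply: reach_leq ab|apply: reach_leq bc]; lia.
Qed.

Lemma proves_fill xi a b : proves a b -> proves (fill xi a) (fill xi b).
Proof.
move=> [k ab]; exists (k + csize (fill xi CoF)).
by apply: reach_leq (reach_fill xi ab); lia.
Qed.

Lemma proves_and a a' b b' :
  proves a a' -> proves b b' -> proves (a && b) (a' && b').
Proof.
move=> aa' bb'; apply: (@proves_trans (a' && b)).
  exact: (@proves_fill (AndL Hole b)).
exact: (@proves_fill (AndR a' Hole)).
Qed.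

Lemma proves_or a a' b b' :
  proves a a' -> proves b b' -> proves (a || b) (a' || b').
Proof.
move=> aa' bb'; apply: (@proves_trans (a' || b)).
  exact: (@proves_fill (OrL Hole b)).
exact: (@proves_fill (OrR a' Hole)).
Qed.

Lemma proves_subst a b : proves a b ->
  exists k, forall sigma K, substitution sigma ->
    (forall x, csize (sigma x) <= K) -> 0 < K ->
    reach (k * K) k (subst sigma a) (subst sigma b).
Proof. by move=> [k ab]; exists k => sigma K sg sgK K0; apply: reach_subst. Qed.

Lemma proves_rule f i : i < size SKSg ->
  let r := nth (CoF, CoF) SKSg i in
  proves (subst (literal_subst f) r.1) (subst (literal_subst f) r.2).
Proof.
move=> iS r; set a := subst _ _; set b := subst _ _.
exists (csize a + csize b).+1; apply: (@reach_step _ _ a a b b); rewrite ?leq_addl; try lia.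
- exact: coseq_refl.
- exists r, Hole, a, b; split=> //; first exact: mem_nth.
  exists id, (literal_subst f); rewrite !rename_id; split=> //.
  exact: literal_substP.
- by apply: reach_eq; [apply: coseq_refl|lia].
Qed.

Lemma proves_em a : proves CoT (a || dual a).
Proof. exact: (@proves_rule (fun=> a) 0 isT). Qed.

Lemma proves_contra a : proves (a && dual a) CoF.
Proof. exact: (@proves_rule (fun=> a) 1 isT). Qed.

Lemma proves_botE a : proves CoF a.
Proof. exact: (@proves_rule (fun=> a) 2 isT). Qed.

Lemma proves_topI a : proves a CoT.
Proof. exact: (@proves_rule (fun=> a) 3 isT). Qed.

Lemma proves_contract a : proves (a || a) a.
Proof. exact: (@proves_rule (fun=> a) 4 isT). Qed.

Lemma proves_copy a : proves a (a && a).
Proof. exact: (@proves_rule (fun=> a) 5 isT). Qed.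

Lemma proves_switch a b c : proves (a && (b || c)) ((a && b) || c).
Proof. exact: (@proves_rule (nth CoF [:: a; b; c]) 6 isT). Qed.

Lemma proves_andl a b : proves (a && b) a.
Proof.
apply: (@proves_trans (a && CoT)); last exact/proves_eq/coseq_andT.
exact: proves_and (proves_refl _) (proves_topI _).
Qed.

Lemma proves_andr a b : proves (a && b) b.
Proof. exact: proves_trans (proves_eq (coseq_andC a b)) (proves_andl _ _). Qed.

Lemma proves_orl a b : proves a (a || b).
Proof.
apply: (@proves_trans (a || CoF)).
  exact/proves_eq/coseq_sym/coseq_orF.
exact: proves_or (proves_refl _) (proves_botE _).
Qed.

Lemma proves_orr a b : proves b (a || b).
Proof. exact: proves_trans (proves_orl _ _) (proves_eq (coseq_orC b a)). Qed.

(** Excluded middle is placed beside two copies of [g]; two switches send one copy into each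
    disjunct, and contraction merges the two results. *)
Lemma proves_cases a g d : proves (g && a) d -> proves (g && dual a) d -> proves g d.
Proof.
move=> ga gna; apply: (@proves_trans (g && CoT)).
  exact/proves_eq/coseq_sym/coseq_andT.
apply: (@proves_trans ((g && g) && (a || dual a))).
  exact: proves_and (proves_copy _) (proves_em _).
apply: proves_trans (proves_eq (coseq_andA _ _ _)) _.
apply: (@proves_trans (g && (dual a || (g && a)))).
  apply: proves_and (proves_refl _) _.
  apply: proves_trans (proves_switch _ _ _) _.
  exact/proves_eq/coseq_orC.
apply: proves_trans (proves_switch _ _ _) _.
exact: proves_trans (proves_or gna ga) (proves_contract _).
Qed.

Lemma proves_mp a b : proves (a && (dual a || b)) b.
Proof.
apply: proves_trans (proves_switch _ _ _) _.
apply: proves_trans (proves_or (proves_contra _) (proves_refl _)) _.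
apply: proves_trans (proves_eq (coseq_orC _ _)) _.
exact/proves_eq/coseq_orF.
Qed.

(** * Completeness for tautologies *)

(* Variables beyond the end of [w] and all atoms are undefined, hence false in
   both polarities. *)
Fixpoint holds (w : seq bool) (a : formula) : bool :=
  match a with
  | CoF | CoAtom _ => false
  | CoT => true
  | CoVar x => (x.1 < size w) && (nth false w x.1 == x.2)
  | CoOr b c => holds w b || holds w c
  | CoAnd b c => holds w b && holds w c
  end.

(** Negation sits only on literals, so truth propagates upwards through disjunctions and
    conjunctions from the literals that [g] yields. *)
Lemma holds_proves g w a :
  (forall i, i < size w -> proves g (CoVar (i, nth false w i))) ->
  holds w a -> proves g a.
Proof.
move=> gw; elim: a => //= [_|[i p]|a IHa b IHb|a IHa b IHb].
- exact: proves_topI.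
- by case/andP=> /= iw /eqP <-; apply: gw.
- case/orP=> [/IHa|/IHb] ga; apply: proves_trans ga _.
    exact: proves_orl.
  exact: proves_orr.
- case/andP=> [/IHa ga /IHb gb].
  exact: proves_trans (proves_copy g) (proves_and ga gb).
Qed.

Lemma tautology_proves n a :
  (forall w, size w = n -> holds w a) -> proves CoT a.
Proof.
(* Invariant of the case analysis: [w] lists the values chosen so far and [g] derives the
   corresponding literals; it starts with [w] empty and [g] equal to [CoT]. *)
suff gen g w : (forall i, i < size w -> proves g (CoVar (i, nth false w i))) ->
    (forall u, size u = n -> holds (w ++ u) a) -> proves g a.
  by move=> wa; apply: (gen _ [::]).
elim: n g w => [|n IH] g w gw wa.
  by apply: holds_proves gw _; rewrite -[w]cats0 wa.
have step p : proves (g && CoVar (size w, p)) a.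
  apply: (IH _ (rcons w p)) => [i|u nu].
    rewrite size_rcons ltnS nth_rcons leq_eqVlt => /predU1P[->|iw].
      by rewrite ltnn eqxx; apply: proves_andr.
    by rewrite iw; apply: proves_trans (proves_andl _ _) (gw _ iw).
  by rewrite cat_rcons wa //= nu.
exact: (proves_cases (step true) (step false)).
Qed.

(** * Simulation of the axioms *)

(** The schemes use three variables only, so each is checked by computation under the eight
    valuations. *)
Lemma scheme_proves F : F \in frege_schemes ->
  proves CoT (translate (fun x => inr (x, true)) F).
Proof.
move=> FS; apply: (@tautology_proves 3) => -[|p [|q [|r []]]] // _.
move: F FS; apply/allP.
by case: p q r => [] [] [].
Qed.

(** Every instance of a scheme translates to a substitution instance of one fixed formula, so one
    derivation per scheme serves all its instances. *)
Lemma translate_frsubst tau sigma F :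
  translate tau (frsubst sigma F) =
  subst (literal_subst (translate tau \o sigma))
    (translate (fun x => inr (x, true)) F).
Proof.
elim: F => //= [F -> G ->|F -> G ->|F -> G ->|F ->] //;
  by rewrite subst_dual //; apply: literal_substP.
Qed.

(* Bounds every value of the substitution by the size of the instance, also at
   the variables that do not occur in [F]. *)
Lemma frsubst_truncate K sigma F : frsize (frsubst sigma F) <= K ->
  frsubst sigma F =
  frsubst (fun x => if frsize (sigma x) <= K then sigma x else FrF) F.
Proof.
elim: F => //= [x ->|F IHF G IHG le|F IHF G IHG le|F IHF G IHG le|F IHF le] //;
  by rewrite -?IHF -?IHG //; lia.
Qed.

Lemma axiom_reach : exists k, forall tau c, frege_axiom c ->
  reach (k * frsize c) k CoT (translate tau c).
Proof.
suff [k kP] : exists k, forall F, F \in frege_schemes ->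
    forall sigma K, substitution sigma -> (forall x, csize (sigma x) <= K) -> 0 < K ->
    reach (k * K) k CoT (subst sigma (translate (fun x => inr (x, true)) F)).
  exists k => tau c [F [sigma [FS ->]]].
  have K0 : 0 < frsize (frsubst sigma F) by rewrite -(csize_translate tau) csize_gt0.
  rewrite {2}(@frsubst_truncate (frsize (frsubst sigma F))) // translate_frsubst.
  apply: kP FS _ _ _ _ (K0); first exact: literal_substP.
  case=> x p; suff: csize (translate tau
      (if frsize (sigma x) <= frsize (frsubst sigma F) then sigma x else FrF)) <=
      frsize (frsubst sigma F).
    by rewrite /literal_subst /=; case: p; rewrite ?csize_dual.
  by rewrite csize_translate; case: ifP.
(* Induction over a list of schemes adds up their individual constants; the inclusion keeps
   membership in the full list available. *)
have: {subset frege_schemes <= frege_schemes} by [].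
elim: {1 3}frege_schemes => [|F Fs IH] sub; first by exists 0.
have /IH[k kP] : {subset Fs <= frege_schemes}.
  by move=> G GFs; apply: sub; rewrite inE GFs orbT.
have /scheme_proves/proves_subst[k' k'P] : F \in frege_schemes.
  by apply: sub; rewrite inE eqxx.
exists (k + k') => G; rewrite inE => /predU1P[->|GFs] sigma K sg sgK K0.
  by apply: reach_leq (k'P _ _ sg sgK K0); rewrite ?leq_mul2r; lia.
by apply: reach_leq (kP _ GFs _ _ sg sgK K0); rewrite ?leq_mul2r; lia.
Qed.

(** * Conjunctions of lists up to equality *)

(** The closing unit treats the empty list like any other and makes concatenation a conjunction; it
    adds one to the size. *)
Definition conjs (s : seq formula) : formula := foldr CoAnd CoT s.

Lemma csize_conj s : csize (conjs s) = (sumn (map csize s)).+1.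
Proof. by elim: s => //= a s ->; rewrite addnS. Qed.

Lemma cos_eq_Tand a : cos_eq (CoT && a) a.
Proof. exact: coseq_trans (coseq_andC _ _) (coseq_andT _). Qed.

Lemma conj_cat s t : cos_eq (conjs (s ++ t)) (conjs s && conjs t).
Proof.
elim: s => [|a s IH] /=; first exact/coseq_sym/cos_eq_Tand.
apply: coseq_trans (coseq_sym (coseq_andA _ _ _)).
exact: cos_eq_and (coseq_refl _) IH.
Qed.

(** Permutations are generated by exchanging adjacent blocks, which associativity and commutativity
    realise. *)
Lemma conj_perm s t : perm_eq s t -> cos_eq (conjs s) (conjs t).
Proof.
move=> st; apply: (@catCA_perm_ind _ (fun u => cos_eq (conjs s) (conjs u)) _ s) st _.
  move=> s1 s2 s3 e123; apply: coseq_trans e123 _; rewrite !catA.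
  apply: coseq_trans (conj_cat _ _) (coseq_trans _ (coseq_sym (conj_cat _ _))).
  apply: cos_eq_and (coseq_refl _).
  apply: coseq_trans (conj_cat _ _) (coseq_trans (coseq_andC _ _) _).
  exact/coseq_sym/conj_cat.
exact: coseq_refl.
Qed.

Lemma conj_bigconj s : cos_eq (bigconj s) (conjs s).
Proof.
case: s => [|a s] /=; first exact: coseq_refl.
elim: s a => [|b s IH] a /=; first exact/coseq_sym/coseq_andT.
exact: coseq_trans (IH _) (coseq_andA _ _ _).
Qed.

Lemma csize_bigconj s :
  sumn (map csize s) <= csize (bigconj s) <= (sumn (map csize s)).+1.
Proof.
case: s => [|a s] //=.
suff ->: csize (foldl CoAnd a s) = csize a + sumn (map csize s) by lia.
by elim: s a => [|b s IH] a /=; rewrite ?addn0 // IH /= addnA.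
Qed.

(** * Simulation of single lines and of whole Frege derivations *)

(** Equality brings [x] to the front, a fixed derivation duplicates it, and equality puts the
    original back, so that it stays available. *)
Lemma copy_reach : exists k, forall m s x, x \in s -> csize (conjs s) <= m ->
  reach (k * m) k (conjs s) (conjs (x :: s)).
Proof.
pose A := CoVar (0, true); pose B := CoVar (1, true).
have /proves_subst[k kP] : proves (A && B) (A && (A && B)).
  apply: proves_trans (proves_eq (coseq_andA A A B)).
  exact: proves_and (proves_copy A) (proves_refl B).
exists (k + 3) => m s x xs sm.
have sx : cos_eq (conjs s) (conjs (x :: rem x s)) by apply/conj_perm/perm_to_rem.
have szx : csize x + csize (conjs (rem x s)) = csize (conjs s).
  have := perm_sumn (perm_map csize (perm_to_rem xs)).
  by rewrite !csize_conj /=; lia.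
pose f := nth CoF [:: x; conjs (rem x s)].
have fm y : csize (literal_subst f y) <= m.
  case: y => i p; suff: csize (f i) <= m.
    by rewrite /literal_subst /=; case: p; rewrite ?csize_dual.
  have := csize_gt0 (conjs s).
  by case: i => [|[|[]]]; rewrite /f /=; lia.
have m0 : 0 < m by have := csize_gt0 (conjs s); lia.
apply: (reach_eql sx).
apply: (reach_leq (m := (k + 3) * m) (r := k + 0)) => //; first by lia.
apply: (reach_trans (b := (x && (x && conjs (rem x s)))%cos)).
  apply: (reach_leq (m := k * m) (r := k)) => //; first by lia.
  exact: kP (literal_substP f) fm m0.
apply: reach_eq; last by rewrite /=; lia.
exact: cos_eq_and (coseq_refl _) (coseq_sym sx).
Qed.

Lemma mp_reach : exists k, forall m s a b, a \in s -> (dual a || b)%cos \in s ->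
  csize (conjs s) <= m -> reach (k * m) k (conjs s) (conjs (b :: s)).
Proof.
have [k kP] := copy_reach.
pose A := CoVar (0, true); pose B := CoVar (1, true); pose C := CoVar (2, true).
have /proves_subst[k' k'P] : proves ((dual A || B) && (A && C)) (B && C).
  apply: (@proves_trans ((A && (dual A || B)) && C)).
    apply: proves_trans (proves_eq (coseq_sym (coseq_andA _ A C))) _.
    exact: proves_eq (cos_eq_and (coseq_andC _ _) (coseq_refl _)).
  exact: proves_and (proves_mp _ _) (proves_refl _).
exists (k + k + k + k') => m s a b as_ abs sm.
have szle x : x \in s -> csize x < csize (conjs s).
  move=> xs; have := perm_sumn (perm_map csize (perm_to_rem xs)).
  by rewrite !csize_conj /=; lia.
have := szle _ as_; have := szle _ abs; rewrite /= csize_dual => szab sza.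
pose f := nth CoF [:: a; b; conjs s].
have fm y : csize (literal_subst f y) <= m.
  case: y => i p; suff: csize (f i) <= m.
    by rewrite /literal_subst /=; case: p; rewrite ?csize_dual.
  have := csize_gt0 (conjs s).
  by case: i => [|[|[|[]]]]; rewrite /f /=; lia.
have m0 : 0 < m by lia.
apply: (reach_leq (m := (k + k + k + k') * m) (r := k + (k + k'))) => //; first by lia.
apply: (reach_trans (b := conjs (a :: s))).
  by apply: reach_leq (kP _ _ _ as_ sm); rewrite ?leq_mul2r; lia.
(* After the first copy the conjunction has size at most [m + m], hence the doubled bound for the
   second. *)
apply: (reach_trans (b := conjs [:: dual a || b, a & s]%cos)).
  apply: (reach_leq (m := k * (m + m)) (r := k)) => //; first by lia.
  by apply: kP; [rewrite inE abs orbT|rewrite /=; lia].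
by apply: reach_leq (k'P _ _ (literal_substP f) fm m0); rewrite ?leq_mul2r; lia.
Qed.

Definition frege_justified (alphas s : seq fformula) (c : fformula) : Prop :=
  [\/ c \in alphas, frege_axiom c | exists2 a, a \in s & FrImp a c \in s].

(** The strict bound on the sizes leaves room for the closing unit of [conjs]. *)
Lemma frege_step_reach : exists k, forall tau used s c m,
  frege_justified used s c ->
  sumn (map frsize used) + sumn (map frsize s) + frsize c < m ->
  reach (k * m) k (conjs (map (translate tau) (rev s ++ used)))
    (conjs (map (translate tau) (c :: rev s ++ used))).
Proof.
have [k kP] := copy_reach; have [k' k'P] := mp_reach.
have [k'' k''P] := axiom_reach.
exists (k + k' + k'' + 2) => tau used s c m sc szm.
pose L := map (translate tau) (rev s ++ used); rewrite map_cons -/L.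
have szL : csize (conjs L) + frsize c <= m.
  rewrite csize_conj /L -map_comp map_cat sumn_cat map_rev sumn_rev.
  by rewrite !(eq_map (csize_translate tau)); lia.
have mem a : a \in s -> translate tau a \in L.
  by move=> as_; apply: map_f; rewrite mem_cat mem_rev as_.
case: sc => [cu|cax|[a as_ acs]].
- apply: reach_leq (kP _ L _ _ (leq_trans (leq_addr _ _) szL)).
  + by rewrite leq_mul2r; lia.
  + by lia.
  + by apply: map_f; rewrite mem_cat cu orbT.
(* An =-step creates the unit, and the axiom is derived from it inside the conjunction. *)
- apply: (reach_eql (b := (CoT && conjs L)%cos)); first exact/coseq_sym/cos_eq_Tand.
  apply: reach_leq (reach_fill (AndL Hole (conjs L)) (k''P tau _ cax)).
    have : k'' * frsize c <= k'' * m by rewrite leq_mul2l; lia.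
    by rewrite /=; lia.
  by lia.
- apply: reach_leq (k'P _ L _ _ (mem _ as_) (mem _ acs) (leq_trans (leq_addr _ _) szL)).
  + by rewrite leq_mul2r; lia.
  + by lia.
Qed.

Lemma frege_reach : exists k, forall tau used s,
  (forall s1 c s2, s = s1 ++ c :: s2 -> frege_justified used s1 c) ->
  let m := (sumn (map frsize used) + sumn (map frsize s)).+1 in
  reach (k * m) (k * size s) (conjs (map (translate tau) used))
    (conjs (map (translate tau) (rev s ++ used))).
Proof.
(* The successor keeps the size bound at least [m], as the empty derivation needs. *)
have [k kP] := frege_step_reach; exists k.+1 => tau used; elim/last_ind=> [|s c IH] sP m.
  apply: reach_eq; first exact: coseq_refl.
  rewrite csize_conj -map_comp (eq_map (csize_translate tau)) /m /=; lia.
have /IH : forall s1 c1 s2, s = s1 ++ c1 :: s2 -> frege_justified used s1 c1.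
  by move=> s1 c1 s2 e; apply: (sP _ _ (rcons s2 c)); rewrite e rcons_cat.
have mE : m = (sumn (map frsize used) + sumn (map frsize s) + frsize c).+1.
  by rewrite /m map_rcons sumn_rcons; lia.
set m' := _.+1 => {}IH.
rewrite rev_rcons size_rcons.
apply: (reach_leq (m := k.+1 * m) (r := k.+1 * size s + k)) => //; first by lia.
apply: (reach_trans (b := conjs (map (translate tau) (rev s ++ used)))).
  by apply: reach_leq IH => //; rewrite leq_mul2l /m'; lia.
apply: reach_leq (kP tau used s c m (sP _ _ [::] _) _); rewrite ?leq_mul2r; try lia.
by rewrite cats1.
Qed.

(** * Treatment of the premisses and assembly *)

(** Inclusion of multisets makes [s] a permutation of a subsequence of [t], and the summands are
    natural numbers. *)
Lemma leq_sumn_count (T : eqType) (f : T -> nat) (s t : seq T) :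
  (forall x, count_mem x s <= count_mem x t) ->
  sumn (map f s) <= sumn (map f t).
Proof.
move=> /count_subseqP[u /perm_to_subseq[v tuv] su].
rewrite (perm_sumn (perm_map f tuv)) (perm_sumn (perm_map f su)).
by rewrite map_cat sumn_cat leq_addr.
Qed.

Theorem theorem4p6 :
  exists c d : nat,
  forall (tau : nat -> name + name) (alphas : seq fformula) (beta : fformula)
    (Ups : seq fformula),
    frege_derivation alphas beta Ups ->
  exists Phi : seq formula,
    [/\ derivation SKSg (bigconj (map (translate tau) alphas)) (translate tau beta) Phi,
        dlength Phi <= c * frlength Ups,
        dsize Phi <= d * (frdsize Ups ^ 2 + csize (bigconj (map (translate tau) alphas)))
      & premisses_occur alphas Ups -> dsize Phi <= d * frdsize Ups ^ 2].
Proof.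
have [k1 k1P] := frege_reach.
have /proves_subst[k2 k2P] := proves_andl (CoVar (0, true)) (CoVar (1, true)).
(* The [3] pays for the opening =-step, the weakening and the closing =-step; the [9] pays for the
   first three formulae of the chain. *)
pose k := k1 + k2; exists (2 * k + 3), ((2 * k + 1) * (3 * k) + 9).
move=> tau alphas beta Ups [[s UpsE] UpsP].
pose used := undup [seq a <- alphas | a \in Ups].
have [rest alphasE] : exists rest, perm_eq alphas (used ++ rest).
  have /perm_to_subseq[rest] : subseq used alphas.
    exact: subseq_trans (undup_subseq _) (filter_subseq _ _).
  by exists rest.
have used_size : sumn (map frsize used) <= frdsize Ups.
  apply: leq_sumn_count; apply: leq_uniq_count; first exact: undup_uniq.
  by move=> a; rewrite mem_undup mem_filter => /andP[].
have used_just s1 c s2 : Ups = s1 ++ c :: s2 -> frege_justified used s1 c.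
  move=> e; case: (UpsP _ _ _ e) => [ca|cax|]; [|by constructor 2|by constructor 3].
  by constructor 1; rewrite mem_undup mem_filter ca e mem_cat inE eqxx orbT.
have sizeE u : sumn (map csize (map (translate tau) u)) = sumn (map frsize u).
  by rewrite -map_comp (eq_map (csize_translate tau)).
have l_gt0 : 0 < size Ups by rewrite UpsE size_rcons.
have l_le_n : size Ups <= frdsize Ups.
  rewrite /frdsize; elim: {+}Ups => //= a u.
  by have := csize_gt0 (translate tau a); rewrite csize_translate; lia.
set P := bigconj _; set n := frdsize Ups in used_size l_le_n *.
set l := size Ups in l_gt0 l_le_n.
have alphas_size := csize_bigconj (map (translate tau) alphas).
rewrite sizeE -/P in alphas_size.
have alphas_split : sumn (map frsize alphas) =
    sumn (map frsize used) + sumn (map frsize rest).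
  by rewrite (perm_sumn (perm_map frsize alphasE)) map_cat sumn_cat.
pose U := conjs (map (translate tau) used); pose V := conjs (map (translate tau) rest).
have U_size : csize U = (sumn (map frsize used)).+1 by rewrite csize_conj sizeE.
have V_size : csize V = (sumn (map frsize rest)).+1 by rewrite csize_conj sizeE.
have PUV : cos_eq P (U && V).
  apply: coseq_trans (conj_bigconj _) (coseq_trans _ (conj_cat _ _)).
  by rewrite -map_cat; apply/conj_perm/perm_map.
(* A single instance of the rule from [A] to [CoT] discards all idle and repeated premisses
   together. *)
have UV_step : rule_step SKSg (U && V) (U && CoT).
  exists (nth (CoF, CoF) SKSg 3), (AndR U Hole), V, CoT; split=> //; first exact: mem_nth.
  by exists id, (literal_subst (fun=> V)); split=> //; apply: literal_substP.
(* The carried conjunction holds the used premisses, the lines and a unit, so its size is at most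
   [n + n + 1], below [3 * n]. *)
have : reach (k * (3 * n)) (k * l) U (translate tau beta).
  have := k1P tau used Ups used_just; rewrite -/(frdsize Ups) -/n -/U -/l.
  (* Reversal puts the last line at the head of the conjunction, from which it is projected. *)
  rewrite UpsE rev_rcons /=; set Y := conjs _ => Ubeta.
  have Y_size : csize (translate tau beta && Y) <= 3 * n.
    have -> : (translate tau beta && Y)%cos =
        conjs (map (translate tau) (rev Ups ++ used)) by rewrite UpsE rev_rcons.
    rewrite csize_conj sizeE map_cat sumn_cat map_rev sumn_rev -/(frdsize Ups) -/n; lia.
  pose f := nth CoF [:: translate tau beta; Y].
  have fn y : csize (literal_subst f y) <= 3 * n.
    case: y => i p; suff: csize (f i) <= 3 * n.
      by rewrite /literal_subst /=; case: p; rewrite ?csize_dual.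
    by move: Y_size; case: i => [|[|[]]]; rewrite /f /=; lia.
  have betaY := k2P _ _ (literal_substP f) fn ltac:(lia).
  apply: (reach_leq (m := k * (3 * n)) (r := k1 * l + k2)) => //; first by rewrite /k; nia.
  apply: (reach_trans (b := (translate tau beta && Y)%cos)).
    by apply: reach_leq Ubeta => //; rewrite /k; nia.
  by apply: reach_leq betaY => //; rewrite leq_mul2r /k; lia.
(* Erasing the unit left by the weakening belongs to the =-step that opens [t], so the alternation
   continues. *)
move=> /(reach_eql (coseq_andT U))/reach_chain[t [t_last t_chain t_len t_size]].
have {t_size} t_size : sumn (map csize t) <= (2 * k + 1) * (3 * k) * n ^ 2.
  (* There are at most [2 * (k * l) + 1] formulae, hence at most [(2 * k + 1) * n], by
     [1 <= l <= n]. *)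
  apply: leq_trans t_size _; rewrite (_ : _ * n ^ 2 = ((2 * k + 1) * n) * (k * (3 * n))); last by nia.
  by apply: leq_mul => //; nia.
have n_le : n <= n ^ 2 by nia.
have Phi_size : dsize [:: P, (U && V)%cos, (U && CoT)%cos & t] <=
    (2 * k + 1) * (3 * k) * n ^ 2 + 2 * csize P + n + 4.
  by rewrite /dsize /=; lia.
exists [:: P, (U && V)%cos, (U && CoT)%cos & t]; split.
- by exists true, [:: (U && V)%cos, (U && CoT)%cos & t]; split.
- by rewrite /dlength /frlength -/l /=; nia.
- apply: leq_trans Phi_size _.
  by have := csize_gt0 P; nia.
- move=> occ; apply: leq_trans Phi_size _.
  have alphas_n : sumn (map frsize alphas) <= n by apply: leq_sumn_count occ.
  by case/andP: alphas_size; nia.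
Qed.
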